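(* Let $\mathcal{I}$ be an ideal on $\omega$. The following are equivalent: (1) $\mathcal{I}$ has the $\mathrm{FinBW}$ property; (2) for every sequence $(f_n)_{n\in\omega}$ of uniformly bounded continuous functions $f_n\colon\mathbb{R}\to\mathbb{R}$ there exist $A\in\mathcal{I}^+$ and a nonempty perfect set $P\subseteq\mathbb{R}$ such that the subsequence $(f_n\restriction P)_{n\in A}$ is uniformly convergent.
   Context: An ideal on $\omega$ is a family $\mathcal{I}\subseteq\mathcal{P}(\omega)$ with $\emptyset\in\mathcal{I}$, $\omega\notin\mathcal{I}$, closed under finite unions and subsets, containing all finite sets; $\mathcal{I}^+=\mathcal{P}(\omega)\setminus\mathcal{I}$. $\mathcal{I}$ has the $\mathrm{FinBW}$ property if for every sequence $(x_n)_{n\in\omega}$ in $[0,1]$ there is $A\in\mathcal{I}^+$ such that the subsequence $(x_n)_{n\in A}$ (indexed by $A$ in increasing order) converges. *)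

(* Defs.v *)
From Stdlib Require Import Reals.
Open Scope R_scope.

Definition finite_nat (A : nat -> Prop) : Prop :=
  exists N : nat, forall n, A n -> (n < N)%nat.

Definition is_ideal (I : (nat -> Prop) -> Prop) : Prop :=
  I (fun _ => False) /\
  ~ I (fun _ => True) /\
  (forall A B, I A -> I B -> I (fun n => A n \/ B n)) /\
  (forall A B, I B -> (forall n, A n -> B n) -> I A) /\
  (forall A, finite_nat A -> I A).

Definition I_positive (I : (nat -> Prop) -> Prop) (A : nat -> Prop) : Prop := ~ I A.

(* The subsequence (x_n)_{n in A} (A enumerated increasingly) converges.
   For infinite A this is exactly convergence along the indices in A. *)
Definition subseq_converges (x : nat -> R) (A : nat -> Prop) : Prop :=
  exists L : R, forall eps : R, eps > 0 ->
    exists N : nat, forall n, A n -> (N <= n)%nat -> Rabs (x n - L) < eps.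

Definition FinBW (I : (nat -> Prop) -> Prop) : Prop :=
  forall x : nat -> R, (forall n, 0 <= x n <= 1) ->
    exists A, I_positive I A /\ subseq_converges x A.

Definition closedR (P : R -> Prop) : Prop :=
  forall x, (forall eps, eps > 0 -> exists y, P y /\ Rabs (y - x) < eps) -> P x.

Definition perfect (P : R -> Prop) : Prop :=
  closedR P /\
  forall x, P x -> forall eps, eps > 0 -> exists y, P y /\ y <> x /\ Rabs (y - x) < eps.

Definition uniformly_bounded (f : nat -> R -> R) : Prop :=
  exists M : R, forall n x, Rabs (f n x) <= M.

Definition subseq_unif_converges_on (f : nat -> R -> R) (A : nat -> Prop)
    (P : R -> Prop) : Prop :=
  exists g : R -> R, forall eps : R, eps > 0 ->
    exists N : nat, forall n, A n -> (N <= n)%nat ->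
      forall x, P x -> Rabs (f n x - g x) < eps.

(* Main.v *)
(* Constant functions give the implication from (2) to (1).  Conversely, coding countably many
   yes/no questions about f_n by ternary digits of a point of [0,1], FinBW yields A positive such
   that f_n(q) -> g(q) along A for every nonnegative rational q.  Whenever { q : g(q) in V } is
   dense in an interval J, one half of V has the same property on some subinterval of any given
   subinterval of J.  Hence a point q of J with g(q) in V has, arbitrarily close to it, two disjoint
   intervals with windows of half the size inside V; this drives a Cantor scheme in which f_n, for
   n in a block of indices, stays near V on the children of J.  The points of a new level are
   controlled only from some later index on, so one scheme cannot serve all of A; two schemes
   taking turns do, and A is, up to a finite set, the union of the two corresponding sets of
   indices, one of which is positive. *)
Require Import Defs.
From Stdlib Require Import Reals.
From Stdlib Require Import ZArith Lra Lia List Classical IndefiniteDescription Cantor.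
Open Scope R_scope.

(** * Dependent choice with an invariant, and powers of one half *)

Lemma dependent_choice_indexed (S : Type) (Inv : nat -> S -> Prop)
    (step : nat -> S -> S -> Prop) (s0 : S) :
  Inv 0%nat s0 ->
  (forall k s, Inv k s -> exists s', Inv (k + 1)%nat s' /\ step k s s') ->
  exists t : nat -> S, t 0%nat = s0 /\
    forall k, Inv k (t k) /\ step k (t k) (t (k + 1)%nat).
Proof.
  intros H0 Hs.
  assert (Hc : forall ks : nat * S, exists s',
    Inv (fst ks) (snd ks) -> Inv (fst ks + 1)%nat s' /\ step (fst ks) (snd ks) s').
  { intros [k s]; simpl. destruct (classic (Inv k s)) as [H|H].
    - destruct (Hs k s H) as [s' Hs']. now exists s'.
    (* Off the invariant the successor is a dummy value. *)
    - exists s. intros H'; contradiction. }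
  apply functional_choice in Hc. destruct Hc as [F HF].
  set (t := fix t k := match k with O => s0 | Datatypes.S k => F (k, t k) end).
  assert (HI : forall k, Inv k (t k)).
  { induction k as [|k IH]; [exact H0|].
    destruct (HF (k, t k) IH) as [H _]. simpl in H.
    rewrite Nat.add_1_r in H. exact H. }
  exists t. split; [reflexivity|]. intros k. split; [apply HI|].
  rewrite Nat.add_1_r. exact (proj2 (HF (k, t k) (HI k))).
Qed.

Lemma Rabs_le_inv (a b : R) : Rabs a <= b -> - b <= a <= b.
Proof.
  intros H. pose proof (Rle_abs a). pose proof (Rle_abs (- a)) as H'.
  rewrite Rabs_Ropp in H'. lra.
Qed.

Lemma half_pow_pos (C : R) (k : nat) : 0 < C -> 0 < C * (/ 2) ^ k.
Proof. intros H. apply Rmult_lt_0_compat; [exact H|]. apply pow_lt. lra. Qed.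

Lemma half_pow_succ (C : R) (k : nat) : C * (/ 2) ^ (k + 1) = C * (/ 2) ^ k / 2.
Proof. rewrite Nat.add_1_r. simpl. lra. Qed.

Lemma half_pow_antitone (C : R) (j k : nat) :
  0 < C -> (j <= k)%nat -> C * (/ 2) ^ k <= C * (/ 2) ^ j.
Proof.
  intros HC H. induction H as [|k _ IH]; [lra|].
  rewrite <- Nat.add_1_r, half_pow_succ. pose proof (half_pow_pos C k HC). lra.
Qed.

Lemma half_pow_small (C eps : R) : 0 < C -> 0 < eps -> exists k, C * (/ 2) ^ k < eps.
Proof.
  intros HC He.
  destruct (pow_lt_1_zero (/ 2)) with (y := eps / C) as [k Hk].
  - rewrite Rabs_pos_eq; lra.
  - now apply Rdiv_lt_0_compat.
  - exists k. specialize (Hk k (le_n k)).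
    rewrite Rabs_pos_eq in Hk by (apply pow_le; lra).
    apply Rmult_lt_compat_l with (r := C) in Hk; [|exact HC].
    replace (C * (eps / C)) with eps in Hk by (field; lra). exact Hk.
Qed.

(** * Positive sets of an ideal *)

Lemma positive_unbounded (I : (nat -> Prop) -> Prop) (A : nat -> Prop) :
  is_ideal I -> I_positive I A -> forall N, exists n, (N <= n)%nat /\ A n.
Proof.
  intros (_ & _ & _ & _ & Hf) HA N. apply NNPP. intros H. apply HA, Hf.
  exists N. intros n An. destruct (Nat.lt_ge_cases n N); [assumption|].
  exfalso. apply H. now exists n.
Qed.

(** Otherwise [A] would be covered by a finite set and two members of the ideal. *)
Lemma positive_split (I : (nat -> Prop) -> Prop) (A B C : nat -> Prop) (N : nat) :
  is_ideal I -> I_positive I A ->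
  (forall n, A n -> (N <= n)%nat -> B n \/ C n) ->
  I_positive I B \/ I_positive I C.
Proof.
  intros (_ & _ & Hu & Hs & Hf) HA H. apply NNPP. intros HN.
  apply not_or_and in HN. destruct HN as [HB HC].
  apply NNPP in HB. apply NNPP in HC. apply HA.
  apply Hs with (B := fun n => (n < N)%nat \/ (B n \/ C n)).
  - apply Hu; [|now apply Hu]. apply Hf. now exists N.
  - intros n An. destruct (Nat.lt_ge_cases n N); auto.
Qed.

(** * Convergence along a positive set at countably many points *)

(** Digits 0 and 2 give points of the Cantor set, where nearby points share their first digits.
    Truncation at [N] digits keeps the sum finite. *)
Fixpoint ternary (b : nat -> bool) (N : nat) : R :=
  match N with
  | O => 0
  | S N => ((if b O then 2 else 0) + ternary (fun m => b (S m)) N) / 3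
  end.

Lemma ternary_bounds (N : nat) : forall b, 0 <= ternary b N <= 1.
Proof.
  induction N as [|N IH]; intros b; simpl; [lra|].
  specialize (IH (fun m => b (S m))). destruct (b O); lra.
Qed.

(** Different leading digits put the values in [[0, 1/3]] and [[2/3, 1]]; dropping an equal leading
    digit triples the distance. The two truncation lengths may differ. *)
Lemma ternary_digit (m : nat) : forall b b' N N',
  (m < N)%nat -> (m < N')%nat ->
  Rabs (ternary b N - ternary b' N') < (/ 3) ^ (m + 1) -> b m = b' m.
Proof.
  induction m as [|m IH]; intros b b' [|N] [|N'] H H' Hd; try lia;
    simpl in Hd; apply Rabs_def2 in Hd.
  - pose proof (ternary_bounds N (fun m => b (S m))).
    pose proof (ternary_bounds N' (fun m => b' (S m))).
    destruct (b O), (b' O); try reflexivity; lra.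
  - pose proof (ternary_bounds N (fun m => b (S m))).
    pose proof (ternary_bounds N' (fun m => b' (S m))).
    assert (Hp : (/ 3) ^ (m + 1) <= 1).
    { rewrite <- (pow1 (m + 1)). apply pow_incr. lra. }
    apply (IH (fun m => b (S m)) (fun m => b' (S m)) N N'); try lia.
    apply Rabs_def1; destruct (b O), (b' O); lra.
Qed.

(** The n-th point of the sequence carries the first [n] answers about [n] as digits; convergence
    along [A] freezes every digit. *)
Lemma FinBW_decides (I : (nat -> Prop) -> Prop) (B : nat -> nat -> bool) :
  FinBW I -> exists A, I_positive I A /\
    forall m, exists c N, forall n, A n -> (N <= n)%nat -> B m n = c.
Proof.
  intros HI.
  destruct (HI (fun n => ternary (fun m => B m n) n)) as (A & HA & L & HL).
  { intros n. apply ternary_bounds. }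
  exists A. split; [exact HA|]. intros m.
  (* Half the gap of [ternary_digit], since two terms are compared through the limit. *)
  destruct (HL ((/ 3) ^ (m + 1) / 2)) as [N HN].
  { apply Rlt_gt, Rdiv_lt_0_compat; [apply pow_lt|]; lra. }
  (* The shift by [S m] ensures that digit [m] survives truncation. If [A] has no such index, the
     claim is vacuous. *)
  destruct (classic (exists n, A n /\ (N + S m <= n)%nat)) as [(n0 & A0 & H0)|H].
  - exists (B m n0), (N + S m)%nat. intros n An Hn.
    apply (ternary_digit m (fun m => B m n) (fun m => B m n0) n n0); try lia.
    pose proof (HN n An ltac:(lia)) as H1. pose proof (HN n0 A0 ltac:(lia)) as H2.
    apply Rabs_def2 in H1. apply Rabs_def2 in H2. apply Rabs_def1; lra.
  - exists true, (N + S m)%nat. intros n An Hn. exfalso. apply H. now exists n.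
Qed.

(** All nonnegative rationals, with repetitions; the successor keeps the denominator nonzero. *)
Definition qenum (k : nat) : R :=
  let (a, p) := Cantor.of_nat k in INR a / INR (S p).

Lemma qenum_dense (x y : R) : 0 <= x -> x < y -> exists k, x < qenum k < y.
Proof.
  intros Hx Hxy.
  destruct (archimed_cor1 (y - x)) as (p & Hp & Hp0); [lra|].
  destruct p as [|p]; [lia|].
  assert (HP : 0 < INR (S p)) by (apply lt_0_INR; lia).
  destruct (archimed (x * INR (S p))) as [Hu1 Hu2].
  assert (Hz : (0 <= up (x * INR (S p)))%Z).
  { apply le_IZR. apply Rle_trans with (x * INR (S p)); [|lra].
    apply Rmult_le_pos; lra. }
  (* The numerator is the first integer above [x * INR (S p)], and the mesh [/ INR (S p)] is smaller
     than [y - x]. *)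
  exists (Cantor.to_nat (Z.to_nat (up (x * INR (S p))), p)).
  unfold qenum. rewrite Cantor.cancel_of_to.
  rewrite INR_IZR_INZ, Z2Nat.id by exact Hz.
  set (u := IZR (up (x * INR (S p)))) in *. set (P := INR (S p)) in *.
  assert (HPP : / P * P = 1) by (field; lra).
  split; apply Rmult_lt_reg_r with P; try exact HP;
    replace (u / P * P) with u by (field; lra); [lra|].
  apply Rmult_lt_compat_r with (r := P) in Hp; [|exact HP]. lra.
Qed.

Lemma converges_of_decided (A : nat -> Prop) (y : nat -> R) (K : R) :
  (forall N, exists n, (N <= n)%nat /\ A n) ->
  (forall n, 0 <= y n <= K) ->
  (forall i, exists N, (forall n, A n -> (N <= n)%nat -> qenum i <= y n) \/
                       (forall n, A n -> (N <= n)%nat -> y n < qenum i)) ->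
  subseq_converges y A.
Proof.
  intros Hinf Hb Hd.
  (* The supremum of the eventual lower bounds is the limit inferior of [y] along [A]. *)
  set (E := fun t => exists N, forall n, A n -> (N <= n)%nat -> t <= y n).
  destruct (completeness E) as [L [HL1 HL2]].
  - exists K. intros t [N HN]. destruct (Hinf N) as (n & Hn & An).
    specialize (HN n An Hn). specialize (Hb n). lra.
  - exists 0, 0%nat. intros n _ _. apply Hb.
  - assert (HL0 : 0 <= L) by (apply HL1; exists 0%nat; intros n _ _; apply Hb).
    exists L. intros eps He.
    (* A rational just above [L] is not an eventual lower bound, so by [Hd] it is an eventual strict
       upper bound. *)
    destruct (qenum_dense L (L + eps)) as [i Hi]; [lra..|].
    destruct (Hd i) as [N1 [H1|H1]].
    { assert (qenum i <= L) by (apply HL1; now exists N1). lra. }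
    assert (H2 : exists t, E t /\ L - eps < t).
    { apply NNPP. intros H. assert (L <= L - eps); [|lra].
      apply HL2. intros t Et. apply Rnot_lt_le. intros Ht. apply H. now exists t. }
    destruct H2 as (t & [N2 H2] & Ht).
    exists (N1 + N2)%nat. intros n An Hn.
    specialize (H1 n An ltac:(lia)). specialize (H2 n An ltac:(lia)).
    apply Rabs_def1; lra.
Qed.

(** The question coded by the pair [(j, i)] asks whether [qenum i] is at most [x j n + M]; the shift
    by [M] makes all values nonnegative, where [qenum] is dense. *)
Lemma FinBW_pointwise (I : (nat -> Prop) -> Prop) (x : nat -> nat -> R) (M : R) :
  is_ideal I -> FinBW I -> (forall j n, Rabs (x j n) <= M) ->
  exists A, I_positive I A /\ forall j, subseq_converges (x j) A.
Proof.
  intros HI HF HM.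
  destruct (FinBW_decides I (fun m n => let (j, i) := Cantor.of_nat m in
    if Rle_dec (qenum i) (x j n + M) then true else false) HF) as (A & HA & Hd).
  exists A. split; [exact HA|]. intros j.
  assert (Hc : subseq_converges (fun n => x j n + M) A).
  { apply converges_of_decided with (2 * M).
    - now apply positive_unbounded with I.
    - intros n. specialize (HM j n). apply Rabs_le_inv in HM. lra.
    - intros i. destruct (Hd (Cantor.to_nat (j, i))) as (c & N & HN).
      rewrite Cantor.cancel_of_to in HN. exists N.
      destruct c; [left|right]; intros n An Hn; specialize (HN n An Hn);
        destruct (Rle_dec (qenum i) (x j n + M)); try discriminate; lra. }
  destruct Hc as [L HL]. exists (L - M). intros eps He.
  destruct (HL eps He) as [N HN]. exists N. intros n An Hn.
  replace (x j n - (L - M)) with (x j n + M - L) by lra. now apply HN.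
Qed.

(** * Cantor schemes of intervals with value windows *)

(** [lo] and [hi] bound an interval of arguments, [bot] and [top] a window of values; [idx] is the
    [qenum] index of a marked point. *)
Record node := Node { lo : R; hi : R; bot : R; top : R; idx : nat }.

Definition in_node (v : node) (x : R) : Prop := lo v <= x <= hi v.

(** The estimate on the child refers to the window of the parent, because the functions with index
    in [B] are controlled near the marked point of the parent. *)
Definition child (f : nat -> R -> R) (w : R) (B : nat -> Prop) (v v' : node) : Prop :=
  lo v <= lo v' /\ hi v' <= hi v /\ hi v' - lo v' <= (hi v - lo v) / 2 /\
  bot v <= bot v' /\ top v' <= top v /\ top v' - bot v' <= (top v - bot v) / 2 /\
  lo v' < hi v' /\ bot v' <= top v' /\
  forall n x, B n -> in_node v' x -> bot v - w <= f n x <= top v + w.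

Definition next_level (f : nat -> R -> R) (w : R) (B : nat -> Prop)
    (L L' : list node) : Prop :=
  (forall v, In v L -> exists v0 v1, In v0 L' /\ In v1 L' /\
     child f w B v v0 /\ child f w B v v1 /\ hi v0 < lo v1) /\
  (forall v', In v' L' -> exists v, In v L /\ child f w B v v').

Definition body (L : nat -> list node) (x : R) : Prop :=
  forall k, exists v, In v (L k) /\ in_node v x.

(** A finite union of closed intervals is closed: finitely many positive distances have a positive
    minimum. *)
Lemma level_closed (L : list node) (x : R) :
  ~ (exists v, In v L /\ in_node v x) ->
  exists eps, eps > 0 /\ forall v y, In v L -> in_node v y -> eps <= Rabs (y - x).
Proof.
  induction L as [|v L IH]; intros H.
  - exists 1. split; [lra|]. intros v y [].
  - destruct IH as (e & He & He').
    { intros (v' & Hv' & Hx). apply H. exists v'. split; [now right|exact Hx]. }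
    assert (Hd : exists d, d > 0 /\ forall y, in_node v y -> d <= Rabs (y - x)).
    { destruct (Rlt_le_dec x (lo v)) as [Hl|Hl].
      - exists (lo v - x). split; [lra|]. intros y [Hy _].
        pose proof (Rle_abs (y - x)). lra.
      - destruct (Rlt_le_dec (hi v) x) as [Hh|Hh].
        + exists (x - hi v). split; [lra|]. intros y [_ Hy].
          rewrite Rabs_minus_sym. pose proof (Rle_abs (x - y)). lra.
        + exfalso. apply H. exists v. split; [now left|now split]. }
    destruct Hd as (d & Hd & Hd').
    exists (Rmin e d). split; [now apply Rmin_glb_lt|].
    intros v' y [<-|Hv'] Hy.
    + apply Rle_trans with d; [apply Rmin_r|now apply Hd'].
    + apply Rle_trans with e; [apply Rmin_l|now apply He' with v'].
Qed.

Lemma body_closed (L : nat -> list node) : closedR (body L).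
Proof.
  intros x Hx k. apply NNPP. intros H.
  destruct (level_closed (L k) x H) as (e & He & He').
  destruct (Hx e He) as (y & Py & Hy). destruct (Py k) as (v & Hv & Hvy).
  specialize (He' v y Hv Hvy). lra.
Qed.

(** The limit is taken along a choice [phi k >= k] in [A]; any late index of [A] is then compared
    with a late [phi m]. *)
Lemma uniformly_cauchy_converges (f : nat -> R -> R) (A : nat -> Prop) (P : R -> Prop) :
  (forall N, exists n, (N <= n)%nat /\ A n) ->
  (forall eps, eps > 0 -> exists N, forall n m, A n -> A m -> (N <= n)%nat ->
     (N <= m)%nat -> forall x, P x -> Rabs (f n x - f m x) < eps) ->
  subseq_unif_converges_on f A P.
Proof.
  intros Hinf Hc. apply functional_choice in Hinf. destruct Hinf as [phi Hphi].
  assert (Hl : forall x, exists l, P x -> Un_cv (fun k => f (phi k) x) l).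
  { intros x. destruct (classic (P x)) as [Px|Px]; [|exists 0; intros; contradiction].
    destruct (R_complete (fun k => f (phi k) x)) as [l Hl]; [|now exists l].
    intros eps He. destruct (Hc eps He) as [N HN]. exists N. intros n m Hn Hm.
    unfold Rdist.
    apply HN; try exact Px; try apply Hphi;
      (eapply Nat.le_trans; [|apply Hphi]); lia. }
  apply functional_choice in Hl. destruct Hl as [g Hg].
  exists g. intros eps He. destruct (Hc (eps / 2)) as [N HN]; [lra|].
  exists N. intros n An Hn x Px.
  destruct (Hg x Px (eps / 2)) as [K HK]; [lra|].
  set (m := (N + K)%nat). destruct (Hphi m) as [H1 H2].
  specialize (HK m ltac:(unfold m; lia)). unfold Rdist in HK.
  specialize (HN n (phi m) An H2 Hn ltac:(unfold m in *; lia) x Px).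
  replace (f n x - g x) with ((f n x - f (phi m) x) + (f (phi m) x - g x)) by lra.
  eapply Rle_lt_trans; [apply Rabs_triang|]. lra.
Qed.

(** * Perfectness of the body of a scheme and uniform convergence on it *)

Section Scheme.
Variables (f : nat -> R -> R) (C : R) (B : nat -> nat -> Prop) (b : nat -> nat).
Variable L : nat -> list node.
Hypothesis C_pos : 0 < C.
Hypothesis B_lt : forall k n, B k n -> (n < b k)%nat.
Hypothesis b_mono : forall k, (b k <= b (k + 1))%nat.
Hypothesis L_step : forall k, next_level f (C * (/ 2) ^ k) (B k) (L k) (L (k + 1)%nat).
Hypothesis L_root : exists v, In v (L 0%nat).
Hypothesis L_init : forall v, In v (L 0%nat) ->
  lo v < hi v /\ hi v - lo v <= C /\ top v - bot v <= C /\ bot v <= top v.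

Lemma scheme_sizes (k : nat) : forall v, In v (L k) ->
  lo v < hi v /\ hi v - lo v <= C * (/ 2) ^ k /\ top v - bot v <= C * (/ 2) ^ k /\
  bot v <= top v.
Proof.
  induction k as [|k IH]; intros v Hv.
  - specialize (L_init v Hv). simpl. lra.
  - rewrite <- Nat.add_1_r in Hv |- *. rewrite half_pow_succ.
    destruct (proj2 (L_step k) v Hv) as (v0 & Hv0 & Hc).
    specialize (IH v0 Hv0). unfold child in Hc. lra.
Qed.

Lemma scheme_ancestor (k : nat) (v : node) (x : R) (i : nat) :
  In v (L (i + k)%nat) -> in_node v x ->
  exists v0, In v0 (L i) /\ in_node v0 x /\ bot v0 <= bot v /\ top v <= top v0.
Proof.
  revert v. induction k as [|k IH]; intros v Hv Hx.
  - rewrite Nat.add_0_r in Hv. exists v. repeat split; try assumption; try apply Hx; lra.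
  - replace (i + S k)%nat with (i + k + 1)%nat in Hv by lia.
    destruct (proj2 (L_step _) v Hv) as (v1 & Hv1 & Hc).
    destruct Hc as (H1 & H2 & _ & H3 & H4 & _). unfold in_node in *.
    destruct (IH v1 Hv1) as (v0 & Hv0 & Hx0 & H5 & H6); [lra|].
    exists v0. repeat split; try assumption; lra.
Qed.

Lemma scheme_point (k : nat) (v : node) :
  In v (L k) -> exists x, in_node v x /\ body L x.
Proof.
  intros Hv.
  destruct (dependent_choice_indexed node (fun i u => In u (L (k + i)%nat))
    (fun _ u u' => lo u <= lo u' /\ hi u' <= hi u) v) as (t & Ht0 & Ht).
  { now rewrite Nat.add_0_r. }
  { intros i u Hu. destruct (proj1 (L_step _) u Hu) as (u' & _ & Hu' & _ & Hc & _).
    exists u'. rewrite Nat.add_assoc. split; [exact Hu'|].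
    unfold child in Hc; lra. }
  assert (Hn : forall i j, lo (t i) <= lo (t (i + j)%nat) /\ hi (t (i + j)%nat) <= hi (t i)).
  { intros i j. induction j as [|j IH]; [rewrite Nat.add_0_r; lra|].
    replace (i + S j)%nat with (i + j + 1)%nat by lia.
    destruct (Ht (i + j)%nat) as [_ H]. lra. }
  assert (Hlt : forall i j, lo (t i) <= hi (t j)).
  { intros i j. destruct (Hn i j) as [H1 _]. destruct (Hn j i) as [_ H2].
    rewrite Nat.add_comm in H2.
    destruct (scheme_sizes _ _ (proj1 (Ht (i + j)%nat))) as [H3 _]. lra. }
  (* The supremum of the left endpoints lies in every interval of the nested branch [t]. *)
  destruct (completeness (fun x => exists i, x = lo (t i))) as [x [Hx1 Hx2]].
  { exists (hi (t 0%nat)). intros y [i ->]. apply Hlt. }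
  { exists (lo (t 0%nat)), 0%nat. reflexivity. }
  assert (Hin : forall i, in_node (t i) x).
  { intros i. split; [apply Hx1; now exists i|]. apply Hx2. intros y [j ->]. apply Hlt. }
  exists x. split; [rewrite <- Ht0; apply Hin|]. intros i.
  (* The node [t i] lies on level [k + i]; its ancestor on level [i] also contains [x]. *)
  destruct (scheme_ancestor k (t i) x i) as (v0 & Hv0 & Hx0 & _).
  - rewrite Nat.add_comm. apply Ht.
  - apply Hin.
  - now exists v0.
Qed.

(** In a node shorter than [eps] around [x], one of the two disjoint children misses [x] and
    supplies the second point. *)
Lemma scheme_perfect : perfect (body L).
Proof.
  split; [apply body_closed|]. intros x Px eps He.
  destruct (half_pow_small C eps C_pos He) as [k Hk].
  destruct (Px k) as (v & Hv & Hx).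
  destruct (proj1 (L_step k) v Hv) as (v0 & v1 & Hv0 & Hv1 & Hc0 & Hc1 & Hlt).
  assert (Hy : exists y, body L y /\ y <> x /\ in_node v y).
  { unfold child, in_node in *. destruct (Rlt_le_dec x (lo v1)) as [H|H].
    - destruct (scheme_point _ _ Hv1) as (y & Hy & Py). unfold in_node in Hy.
      exists y. split; [exact Py|]. split; lra.
    - destruct (scheme_point _ _ Hv0) as (y & Hy & Py). unfold in_node in Hy.
      exists y. split; [exact Py|]. split; lra. }
  destruct Hy as (y & Py & Hne & Hy). exists y. split; [exact Py|]. split; [exact Hne|].
  destruct (scheme_sizes k v Hv) as (_ & Hs & _). unfold in_node in *.
  apply Rabs_def1; lra.
Qed.

(** The level-[j] ancestor has a window of height at most [C * (/ 2) ^ j] containing [bot v], and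
    [f n x] leaves that window by at most the same amount. *)
Lemma scheme_window (j d n : nat) (v : node) (x : R) :
  In v (L (j + 1 + d)%nat) -> in_node v x -> B j n ->
  Rabs (f n x - bot v) <= 2 * (C * (/ 2) ^ j).
Proof.
  intros Hv Hx Hn.
  destruct (scheme_sizes _ v Hv) as (_ & _ & _ & Hw).
  destruct (scheme_ancestor d v x (j + 1) Hv Hx) as (u & Hu & Hux & H1 & H2).
  destruct (proj2 (L_step j) u Hu) as (q & Hq & Hc).
  destruct Hc as (_ & _ & _ & H3 & H4 & _ & _ & _ & Hf).
  specialize (Hf n x Hn Hux).
  destruct (scheme_sizes j q Hq) as (_ & _ & Hs & _).
  apply Rabs_le. lra.
Qed.

(** Both values are compared with [bot v] for one node [v] around [x] on level [k + 1]. *)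
Lemma scheme_cauchy (j k n m : nat) (x : R) :
  body L x -> (j <= k)%nat -> B j n -> B k m ->
  Rabs (f n x - f m x) <= 4 * (C * (/ 2) ^ j).
Proof.
  intros Px Hjk Hn Hm.
  destruct (Px (k + 1 + 0)%nat) as (v & Hv & Hx).
  pose proof (scheme_window k 0 m v x Hv Hx Hm) as H1.
  replace (k + 1 + 0)%nat with (j + 1 + (k - j))%nat in Hv by lia.
  pose proof (scheme_window j (k - j) n v x Hv Hx Hn) as H2.
  pose proof (half_pow_antitone C j k C_pos Hjk).
  apply Rabs_le_inv in H1. apply Rabs_le_inv in H2. apply Rabs_le. lra.
Qed.

Lemma scheme_converges :
  (forall N, exists n, (N <= n)%nat /\ exists k, B k n) ->
  subseq_unif_converges_on f (fun n => exists k, B k n) (body L).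
Proof.
  intros Hinf. apply uniformly_cauchy_converges; [exact Hinf|]. intros eps He.
  destruct (half_pow_small C (eps / 4) C_pos) as [K HK]; [lra|].
  assert (Hb : forall i k, (k <= i)%nat -> (b k <= b i)%nat).
  { intros i k H. induction H as [|i _ IH]; [lia|].
    specialize (b_mono i). rewrite Nat.add_1_r in b_mono. lia. }
  (* Blocks before the K-th end below [b K], so late indices lie in blocks with small tolerance. *)
  assert (Hlate : forall k n, B k n -> (b K <= n)%nat -> (K <= k)%nat).
  { intros k n Hk Hn. destruct (Nat.lt_ge_cases k K) as [H|H]; [|exact H].
    specialize (B_lt k n Hk). specialize (Hb K k ltac:(lia)). lia. }
  exists (b K). intros n m [j Hj] [k Hk] Hn Hm x Px.
  pose proof (half_pow_antitone C K j C_pos (Hlate j n Hj Hn)).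
  pose proof (half_pow_antitone C K k C_pos (Hlate k m Hk Hm)).
  destruct (Nat.le_ge_cases j k) as [H1|H1].
  - pose proof (scheme_cauchy j k n m x Px H1 Hj Hk). lra.
  - rewrite Rabs_minus_sym.
    pose proof (scheme_cauchy k j m n x Px H1 Hk Hj). lra.
Qed.

Lemma scheme_nonempty : exists x, body L x.
Proof.
  destruct L_root as [v Hv]. destruct (scheme_point 0 v Hv) as (x & _ & Px). now exists x.
Qed.

End Scheme.

(** * Building the scheme *)

Definition dense_window (g : nat -> R) (l r u v : R) : Prop :=
  forall x y, l <= x -> x < y -> y <= r ->
    exists j, x < qenum j < y /\ u <= g j <= v.

(** If the lower half of the window fails on some subinterval, values in the window taken there all
    lie in the upper half, which is then dense on it. *)
Lemma dense_window_halve (g : nat -> R) (l r u v : R) :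
  l < r -> u <= v -> dense_window g l r u v ->
  exists l' r' u' v', l <= l' /\ l' < r' /\ r' <= r /\ u <= u' /\ u' <= v' /\ v' <= v /\
    v' - u' <= (v - u) / 2 /\ dense_window g l' r' u' v'.
Proof.
  intros Hlr Huv Hd. set (m := (u + v) / 2).
  destruct (classic (dense_window g l r u m)) as [H|H].
  - exists l, r, u, m. unfold m in *. repeat split; try lra. exact H.
  - assert (H' : exists x y, l <= x /\ x < y /\ y <= r /\
      forall j, x < qenum j < y -> ~ u <= g j <= m).
    { apply NNPP. intros H1. apply H. intros x y Hx Hxy Hy. apply NNPP. intros H2.
      apply H1. exists x, y. repeat split; try assumption.
      intros j Hj Hg. apply H2. now exists j. }
    destruct H' as (x & y & Hx & Hxy & Hy & Hno).
    exists x, y, m, v. unfold m in *. repeat split; try lra.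
    intros x' y' Hx' Hxy' Hy'. destruct (Hd x' y') as (j & Hj & Hg); [lra..|].
    exists j. split; [exact Hj|]. specialize (Hno j ltac:(lra)). lra.
Qed.

(** The marked point is interior, which leaves room to its right for the children. *)
Definition good (g : nat -> R) (v : node) : Prop :=
  lo v < qenum (idx v) < hi v /\ bot v <= g (idx v) <= top v /\
  dense_window g (lo v) (hi v) (bot v) (top v).

(** Density passes to [[l, r]]; after halving the window, density supplies a new marked point. *)
Lemma good_subnode (g : nat -> R) (v : node) (l r : R) :
  good g v -> lo v <= l -> l < r -> r <= hi v ->
  exists v', good g v' /\ l <= lo v' /\ hi v' <= r /\
    bot v <= bot v' /\ top v' <= top v /\ top v' - bot v' <= (top v - bot v) / 2.
Proof.
  intros (_ & Hg & Hd) Hl Hlr Hr.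
  destruct (dense_window_halve g l r (bot v) (top v))
    as (l' & r' & u' & v' & H1 & H2 & H3 & H4 & H5 & H6 & H7 & H8); [lra..| |].
  { intros x y Hx Hxy Hy. apply Hd; lra. }
  destruct (H8 l' r') as (j & Hj & Hgj); [lra..|].
  exists (Node l' r' u' v' j). unfold good; simpl. repeat split; try lra. exact H8.
Qed.

(** A minimum over finitely many functions, which is why blocks of indices are bounded. *)
Lemma common_modulus (f : nat -> R -> R) (p eps : R) (b : nat) :
  (forall n, continuity (f n)) -> eps > 0 ->
  exists delta, delta > 0 /\ forall n x, (n < b)%nat -> Rabs (x - p) < delta ->
    Rabs (f n x - f n p) < eps.
Proof.
  intros Hf He. induction b as [|b (d & Hd & IH)].
  - exists 1. split; [lra|]. intros; lia.
  - destruct (Hf b p eps He) as (d' & Hd' & H).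
    exists (Rmin d d'). split; [now apply Rmin_glb_lt|]. intros n x Hn Hx.
    destruct (Nat.eq_dec n b) as [->|Hne].
    (* The limit in the definition of continuity excludes the point [p] itself. *)
    + destruct (Req_dec x p) as [->|Hxp].
      { rewrite Rminus_diag, Rabs_R0. lra. }
      apply (H x). split.
      * split; [exact Logic.I|]. intros E. now apply Hxp.
      * apply Rlt_le_trans with (1 := Hx). apply Rmin_r.
    + apply IH; [lia|]. apply Rlt_le_trans with (1 := Hx). apply Rmin_l.
Qed.

Definition tracked (f : nat -> R -> R) (g : nat -> R) (w : R) (B : nat -> Prop)
    (v : node) : Prop :=
  forall n, B n -> Rabs (f n (qenum (idx v)) - g (idx v)) <= w.

(** One [w] comes from tracking at the marked point, the other from continuity there. *)
Lemma good_children (f : nat -> R -> R) (g : nat -> R) (w : R) (B : nat -> Prop)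
    (b : nat) (v : node) :
  (forall n, continuity (f n)) -> w > 0 -> (forall n, B n -> (n < b)%nat) ->
  good g v -> tracked f g w B v ->
  exists v0 v1, good g v0 /\ good g v1 /\
    child f (2 * w) B v v0 /\ child f (2 * w) B v v1 /\ hi v0 < lo v1.
Proof.
  intros Hf Hw Hb Hv Ht.
  destruct (common_modulus f (qenum (idx v)) w b Hf Hw) as (d & Hd & Hm).
  pose proof Hv as (Hq & Hg & _).
  set (p := qenum (idx v)) in *.
  (* Keeps [[p, p + e]] within the modulus, inside [v], and at most half as long as [v]; the
     children go into its outer thirds. *)
  set (e := Rmin (d / 2) (Rmin (hi v - p) ((hi v - lo v) / 2))).
  assert (He : 0 < e).
  { unfold e. repeat apply Rmin_glb_lt; lra. }
  assert (He1 : e <= d / 2) by apply Rmin_l.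
  assert (He2 : e <= hi v - p) by (eapply Rle_trans; [apply Rmin_r|apply Rmin_l]).
  assert (He3 : e <= (hi v - lo v) / 2) by (eapply Rle_trans; [apply Rmin_r|apply Rmin_r]).
  destruct (good_subnode g v p (p + e / 3)) as (v0 & G0 & A0); [assumption|lra..|].
  destruct (good_subnode g v (p + 2 * e / 3) (p + e)) as (v1 & G1 & A1);
    [assumption|lra..|].
  assert (Hest : forall n x, B n -> p <= x <= p + e ->
    bot v - 2 * w <= f n x <= top v + 2 * w).
  { intros n x Hn Hx. specialize (Ht n Hn). fold p in Ht.
    apply Rabs_le_inv in Ht.
    assert (H : Rabs (f n x - f n p) < w).
    { apply Hm; [now apply Hb|]. apply Rabs_def1; lra. }
    apply Rabs_def2 in H. lra. }
  pose proof G0 as (Q0 & W0 & _). pose proof G1 as (Q1 & W1 & _).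
  exists v0, v1. split; [exact G0|]. split; [exact G1|].
  unfold child, in_node. repeat split; try lra; try apply Hest; try assumption; try lra.
Qed.

Lemma good_next_level (f : nat -> R -> R) (g : nat -> R) (w : R) (B : nat -> Prop)
    (b : nat) (L : list node) :
  (forall n, continuity (f n)) -> w > 0 -> (forall n, B n -> (n < b)%nat) ->
  Forall (good g) L -> Forall (tracked f g w B) L ->
  exists L', Forall (good g) L' /\ next_level f (2 * w) B L L'.
Proof.
  intros Hf Hw Hb. induction L as [|v L IH]; intros HG HT.
  - exists nil. split; [constructor|]. split; intros v [].
  - inversion_clear HG as [|? ? Gv GL]. inversion_clear HT as [|? ? Tv TL].
    destruct (IH GL TL) as (L' & GL' & Hd & Hu).
    destruct (good_children f g w B b v Hf Hw Hb Gv Tv)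
      as (v0 & v1 & G0 & G1 & C0 & C1 & Hlt).
    exists (v0 :: v1 :: L'). split; [auto using Forall_cons|]. split.
    + intros u [<-|Hu']; [exists v0, v1; simpl; tauto|].
      destruct (Hd u Hu') as (u0 & u1 & H). exists u0, u1. simpl; tauto.
    + intros u [<-|[<-|Hu']]; [exists v; simpl; tauto..|].
      destruct (Hu u Hu') as (u0 & H). exists u0. simpl; tauto.
Qed.

(** A level has finitely many marked points, so one threshold serves them all. *)
Lemma eventually_tracked (f : nat -> R -> R) (g : nat -> R) (A : nat -> Prop) (w : R)
    (L : list node) (N : nat) :
  w > 0 ->
  (forall j eps, eps > 0 -> exists N, forall n, A n -> (N <= n)%nat ->
     Rabs (f n (qenum j) - g j) < eps) ->
  exists N', (N < N')%nat /\ Forall (tracked f g w (fun n => A n /\ (N' <= n)%nat)) L.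
Proof.
  intros Hw Hg. induction L as [|v L (N1 & HN1 & IH)].
  - exists (S N). split; [lia|constructor].
  - destruct (Hg (idx v) w Hw) as [N2 H2].
    exists (N1 + N2)%nat. split; [lia|]. constructor.
    + intros n [An Hn]. left. apply H2; [exact An|lia].
    + apply Forall_impl with (2 := IH). intros u Hu n [An Hn]. apply Hu. split; [exact An|lia].
Qed.

(** * Two schemes taking turns on consecutive blocks of indices *)

Record stage := Stage { left_level : list node; right_level : list node; start : nat }.

Definition block (A : nat -> Prop) (a b n : nat) : Prop := A n /\ (a <= n < b)%nat.

(** While one scheme uses its block, the other waits until its marked points are tracked. *)
Definition stage_step (f : nat -> R -> R) (A : nat -> Prop) (w : R) (s s' : stage) : Prop :=
  exists c, (start s < c)%nat /\ (c < start s')%nat /\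
    next_level f w (block A (start s) c) (left_level s) (left_level s') /\
    next_level f w (block A c (start s')) (right_level s) (right_level s').

Lemma stages_exist (f : nat -> R -> R) (g : nat -> R) (A : nat -> Prop) (C : R) (v : node) :
  (forall n, continuity (f n)) -> C > 0 -> good g v ->
  (forall j eps, eps > 0 -> exists N, forall n, A n -> (N <= n)%nat ->
     Rabs (f n (qenum j) - g j) < eps) ->
  exists t : nat -> stage, left_level (t 0%nat) = v :: nil /\
    right_level (t 0%nat) = v :: nil /\
    forall k, stage_step f A (C * (/ 2) ^ k) (t k) (t (k + 1)%nat).
Proof.
  intros Hf HC Hv Hg.
  (* Half the tolerance, because [good_next_level] doubles it. *)
  assert (Hw : forall k, C * (/ 2) ^ k / 2 > 0).
  { intros k. pose proof (half_pow_pos C k HC). lra. }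
  destruct (eventually_tracked f g A (C * (/ 2) ^ 0 / 2) (v :: nil) 0 (Hw 0%nat) Hg)
    as (N0 & _ & HN0).
  (* Only the left level is tracked from [start s]; the right one is tracked from the [c] chosen
     within the step. *)
  destruct (dependent_choice_indexed stage
    (fun k s => Forall (good g) (left_level s) /\ Forall (good g) (right_level s) /\
       Forall (tracked f g (C * (/ 2) ^ k / 2) (fun n => A n /\ (start s <= n)%nat))
         (left_level s))
    (fun k => stage_step f A (C * (/ 2) ^ k))
    (Stage (v :: nil) (v :: nil) N0)) as (t & Ht0 & Ht).
  - simpl. auto using Forall_cons.
  - intros k [L L' N] (GL & GL' & TL); simpl in *.
    destruct (eventually_tracked f g A (C * (/ 2) ^ k / 2) L' N (Hw k) Hg)
      as (c & Hc & Tc).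
    destruct (good_next_level f g (C * (/ 2) ^ k / 2) (block A N c) c L)
      as (L1 & GL1 & NL1); try assumption.
    { apply Hw. }
    { intros n [_ Hn]. lia. }
    { apply Forall_impl with (2 := TL). intros u Hu n [An Hn]. apply Hu. now split. }
    destruct (eventually_tracked f g A (C * (/ 2) ^ (k + 1) / 2) L1 c (Hw _) Hg)
      as (N' & HN' & TN').
    destruct (good_next_level f g (C * (/ 2) ^ k / 2) (block A c N') N' L')
      as (L2 & GL2 & NL2); try assumption.
    { apply Hw. }
    { intros n [_ Hn]. lia. }
    { apply Forall_impl with (2 := Tc). intros u Hu n [An Hn]. apply Hu. now split. }
    replace (2 * (C * (/ 2) ^ k / 2)) with (C * (/ 2) ^ k) in NL1, NL2 by lra.
    exists (Stage L1 L2 N'). simpl. split; [now repeat split|].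
    exists c. simpl. repeat split; try assumption; try apply NL1; apply NL2.
  - exists t. rewrite Ht0. simpl. repeat split. intros k. apply Ht.
Qed.

Lemma pointwise_limit_gives_perfect (I : (nat -> Prop) -> Prop) (f : nat -> R -> R)
    (g : nat -> R) (A : nat -> Prop) (M : R) :
  is_ideal I -> I_positive I A -> (forall n, continuity (f n)) ->
  (forall j, Rabs (g j) <= M) ->
  (forall j eps, eps > 0 -> exists N, forall n, A n -> (N <= n)%nat ->
     Rabs (f n (qenum j) - g j) < eps) ->
  exists (A' : nat -> Prop) (P : R -> Prop),
    I_positive I A' /\ (exists x, P x) /\ perfect P /\ subseq_unif_converges_on f A' P.
Proof.
  intros HI HA Hf HM Hg.
  assert (HM0 : 0 <= M) by (eapply Rle_trans; [apply Rabs_pos|apply (HM 0%nat)]).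
  destruct (qenum_dense 0 1) as [j0 Hj0]; [lra..|].
  assert (Hv : good g (Node 0 1 (- M) M j0)).
  { unfold good; simpl. split; [exact Hj0|]. split; [now apply Rabs_le_inv|].
    intros x y Hx Hxy Hy. destruct (qenum_dense x y Hx Hxy) as [j Hj].
    exists j. split; [exact Hj|]. now apply Rabs_le_inv. }
  (* Bounds both the root length 1 and the window height [2 * M], and is positive even if [M] is
     0. *)
  set (C := 2 * M + 1). assert (HC : C > 0) by (unfold C; lra).
  destruct (stages_exist f g A C _ Hf HC Hv Hg) as (t & Hl0 & Hr0 & Ht).
  apply functional_choice in Ht. destruct Ht as [c Ht].
  set (BL k := block A (start (t k)) (c k)).
  set (BR k := block A (c k) (start (t (k + 1)%nat))).
  assert (Hroot : forall v, In v (Node 0 1 (- M) M j0 :: nil) ->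
    lo v < hi v /\ hi v - lo v <= C /\ top v - bot v <= C /\ bot v <= top v).
  { intros v [<-|[]]. unfold C; simpl. lra. }
  assert (Hfind : forall n, (start (t 0%nat) <= n)%nat ->
    exists k, (start (t k) <= n < start (t (k + 1)))%nat).
  { intros n Hn. induction Hn as [|n _ (k & IH)].
    - exists 0%nat. destruct (Ht 0%nat) as (H1 & H2 & _). simpl in *. lia.
    - destruct (Nat.eq_dec (S n) (start (t (k + 1)%nat))) as [E|E].
      + exists (k + 1)%nat. destruct (Ht (k + 1)%nat) as (H1 & H2 & _). lia.
      + exists k. lia. }
  (* From [start (t 0)] on, every index of [A] is in a left or a right block, so one of the two
     unions is positive. *)
  destruct (positive_split I A (fun n => exists k, BL k n) (fun n => exists k, BR k n)
    (start (t 0%nat)) HI HA) as [HP|HP].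
  { intros n An Hn. destruct (Hfind n Hn) as [k Hk].
    destruct (Nat.lt_ge_cases n (c k)); [left|right]; exists k; unfold BL, BR, block;
      split; (assumption || lia). }
  - set (L k := left_level (t k)).
    assert (HB : forall k n, BL k n -> (n < c k)%nat) by (intros k n [_ Hn]; lia).
    assert (Hm : forall k, (c k <= c (k + 1))%nat).
    { intros k. destruct (Ht k) as (_ & H1 & _). destruct (Ht (k + 1)%nat) as (H2 & _). lia. }
    assert (HL : forall k, next_level f (C * (/ 2) ^ k) (BL k) (L k) (L (k + 1)%nat))
      by (intros k; apply Ht).
    assert (Hr : exists v, In v (L 0%nat)) by (unfold L; rewrite Hl0; eexists; now left).
    assert (Hi : forall v, In v (L 0%nat) ->
      lo v < hi v /\ hi v - lo v <= C /\ top v - bot v <= C /\ bot v <= top v)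
      by (unfold L; rewrite Hl0; exact Hroot).
    exists (fun n => exists k, BL k n), (body L). split; [exact HP|].
    split; [now apply scheme_nonempty with f C BL|].
    split; [now apply scheme_perfect with f C BL|].
    apply scheme_converges with C c; try assumption.
    now apply positive_unbounded with I.
  - set (L k := right_level (t k)).
    set (b k := start (t (k + 1)%nat)).
    assert (HB : forall k n, BR k n -> (n < b k)%nat) by (intros k n [_ Hn]; unfold b; lia).
    assert (Hm : forall k, (b k <= b (k + 1))%nat).
    { intros k. unfold b. destruct (Ht (k + 1)%nat) as (H1 & H2 & _). lia. }
    assert (HL : forall k, next_level f (C * (/ 2) ^ k) (BR k) (L k) (L (k + 1)%nat))
      by (intros k; apply Ht).
    assert (Hr : exists v, In v (L 0%nat)) by (unfold L; rewrite Hr0; eexists; now left).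
    assert (Hi : forall v, In v (L 0%nat) ->
      lo v < hi v /\ hi v - lo v <= C /\ top v - bot v <= C /\ bot v <= top v)
      by (unfold L; rewrite Hr0; exact Hroot).
    exists (fun n => exists k, BR k n), (body L). split; [exact HP|].
    split; [now apply scheme_nonempty with f C BR|].
    split; [now apply scheme_perfect with f C BR|].
    apply scheme_converges with C b; try assumption.
    now apply positive_unbounded with I.
Qed.

Theorem theorem7p1 (I : (nat -> Prop) -> Prop) (HI : is_ideal I) :
  FinBW I <->
  (forall f : nat -> R -> R,
     (forall n, continuity (f n)) -> uniformly_bounded f ->
     exists (A : nat -> Prop) (P : R -> Prop),
       I_positive I A /\ (exists x, P x) /\ perfect P /\
       subseq_unif_converges_on f A P).
Proof.
  split.
  - intros HF f Hf [M HM].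
    destruct (FinBW_pointwise I (fun j n => f n (qenum j)) M HI HF) as (A & HA & Hc).
    { intros j n. apply HM. }
    apply functional_choice in Hc. destruct Hc as [g Hg].
    apply pointwise_limit_gives_perfect with g A M; try assumption.
    (* The bound [M] passes to the limit: a larger value would contradict a late index of [A]. *)
    intros j. apply Rnot_lt_le. intros Hlt.
    destruct (Hg j (Rabs (g j) - M)) as [N HN]; [lra|].
    destruct (positive_unbounded I A HI HA N) as (n & Hn & An).
    specialize (HN n An Hn). specialize (HM n (qenum j)).
    pose proof (Rabs_triang_inv (g j) (f n (qenum j))) as Ht.
    rewrite Rabs_minus_sym in Ht. lra.
  (* Constant functions turn uniform convergence on [P] into convergence of [x] at any point [p] of
     [P]. *)
  - intros H x Hx.
    destruct (H (fun n _ => x n)) as (A & P & HA & (p & Pp) & _ & g & Hg).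
    { intros n. apply continuity_const. intros y z. reflexivity. }
    { exists 1. intros n _. apply Rabs_le. specialize (Hx n). lra. }
    exists A. split; [exact HA|]. exists (g p). intros eps He.
    destruct (Hg eps He) as [N HN]. exists N. intros n An Hn. now apply (HN n An Hn p).
Qed.
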